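(* Let $ABC$ be a triangle and $P$ a point not on the extended sides of $ABC$ or of its anticomplementary triangle. (a) The point $K(Q)$ is the center of the nine-point conic $\mathcal{N}_{P'}$ (with respect to $l_\infty$) for the quadrangle $ABCP'$. (b) The circumconic $\tilde{\mathcal{C}}_O = T_{P'}^{-1}(\mathcal{N}_{P'})$ of $ABC$ is the nine-point conic (with respect to $l_\infty$) for the quadrangle formed by the point $Q$ and the vertices of the anticevian triangle of $Q$ with respect to $ABC$. Its center is $O = T_{P'}^{-1}K(Q)$. (c) If $P$ does not lie on a median of $ABC$ or on $\iota(l_\infty)$, and $O', H'$ are the generalized circumcenter and generalized orthocenter corresponding to the point $P'$, then $O' = \eta(O)$ and $H' = \eta(H)$. Thus $OO'$ and $HH'$ are parallel to $PP'$.
   Context: We work in the Euclidean plane extended by the line at infinity $l_\infty$; affine maps act on the extended plane. Two lines are parallel if they meet $l_\infty$ in the same point (a line is parallel to itself). Products of lines such as $AP\cdot BC$ denote intersection points; juxtaposition of maps is composition. The center of a conic is the pole of $l_\infty$ with respect to it. $ABC$ is a triangle with centroid $G$; $D_0,E_0,F_0$ are the midpoints of $BC,CA,AB$. $K$ is the complement map, the homothety with center $G$ and ratio $-1/2$; $K^{-1}(ABC)$ is the anticomplementary triangle. $D=AP\cdot BC$, $E=BP\cdot CA$, $F=CP\cdot AB$ are the traces of $P$. $D_3,E_3,F_3$ are the reflections of $D,E,F$ in $D_0,E_0,F_0$; the lines $AD_3,BE_3,CF_3$ concur in $P'=\iota(P)$, the isotomic conjugate of $P$ (in barycentric coordinates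 $\iota(x:y:z)=(1/x:1/y:1/z)$). $\iota(l_\infty)$ is the Steiner circumellipse. $Q=K(P')$, $Q'=K(P)$. $T_{P'}$ is the unique affine map taking $A,B,C$ to $D_3,E_3,F_3$, respectively. The generalized circumcenter $O$ of $P$ is the point for which $OD_0,OE_0,OF_0$ are parallel respectively to $QD,QE,QF$; the generalized orthocenter $H$ of $P$ is the point for which $HA,HB,HC$ are parallel respectively to $QD,QE,QF$. $O',H'$ are the corresponding points when $P$ is replaced by $P'$ (so $Q,D,E,F$ are replaced by $Q',D_3,E_3,F_3$). The nine-point conic of a quadrangle with respect to $l_\infty$ is the conic through its three diagonal points and the midpoints of its six sides; equivalently, it is the locus of centers of the conics through its four vertices, where the center of a degenerate conic (pair of opposite sides) is the intersection of its two lines. (If one vertex is at infinity, the ''midpoint'' of a side through it is the infinite vertex itself.) The anticevian triangle of $Q$ with respect to $ABC$ is the triangle $Q_aQ_bQ_c$ with $A=Q_bQ_c\cdot QQ_a$, $B=Q_aQ_c\cdot QQ_b$, $C=Q_aQ_b\cdot QQ_c$. With $V=PQ\cdot P'Q'$, $\eta$ is the affine reflection that fixes the line $GV$ pointwise and interchanges $P$ and $P'$, moving points along lines parallel to $PP'$. *)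

(* Defs.v *)
From mathcomp Require Import all_boot all_order all_algebra.

Set Implicit Arguments.
Unset Strict Implicit.
Unset Printing Implicit Defensive.

Import Order.TTheory GRing.Theory Num.Theory.
Local Open Scope ring_scope.

(* Points and lines of the extended plane are nonzero vectors of homogeneous  *)
(* coordinates in 'rV[R]_3, and two of them are the same point (or line) when *)
(* they span the same row space, i.e. when (u == v)%MS. The line at infinity  *)
(* is where the last coordinate vanishes; affine maps are 3 x 3 matrices      *)
(* acting on points by right multiplication, so that the image of p under the *)
(* composite S T ("first T, then S") is p *m T *m S.                          *)

Section ExtendedPlane.
Variable R : realFieldType.
Implicit Types (X Y : 'rV[R]_2) (p q l m : 'rV[R]_3) (M N : 'M[R]_3).

Definition ordpt X : 'rV[R]_3 := row_mx X 1%:M.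

Definition linf : 'rV[R]_3 := row_mx (0 : 'rV[R]_2) 1%:M.

(* The indices live in the additive group 'I_3, i.e. are taken modulo 3. *)
Definition cross (u v : 'rV[R]_3) : 'rV[R]_3 :=
  \row_(k < 3) (u 0 (k + 1) * v 0 (k + 2%:R) - u 0 (k + 2%:R) * v 0 (k + 1)).

Definition line p q : 'rV[R]_3 := cross p q.
Definition inter l m : 'rV[R]_3 := cross l m.
Definition on p l : bool := p *m l^T == 0.

Definition parallel l m : bool := (inter l linf == inter m linf)%MS.

(* "pq is parallel to l", where p = q is allowed: this says that q lies on    *)
(* the parallel to l through p. For instance the circumcenter of a right      *)
(* triangle is the midpoint of the hypotenuse.                                *)
Definition join_parallel p q l : bool :=
  (p == q)%MS || parallel (line p q) l.

Definition weight p : R := p 0 ord_max.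

(* For ordinary p, q this is (p / weight p + q / weight q) / 2 up to a        *)
(* factor; if exactly one of p, q is at infinity, it is that point.           *)
Definition midpoint p q : 'rV[R]_3 := weight q *: p + weight p *: q.

Definition affine M : bool := (M \in unitmx) && (M *m linf^T == linf^T).

(* X |-> G + k (X - G) *)
Definition homothety (G : 'rV[R]_2) (k : R) : 'M[R]_3 :=
  block_mx k%:M 0 ((1 - k) *: G) 1%:M.

Definition point_reflection (G : 'rV[R]_2) : 'M[R]_3 := homothety G (- 1).

(* A conic is a nonzero symmetric matrix up to a scalar factor. *)
Definition conic N : bool := (N^T == N) && (N != 0).

Definition on_conic N p : bool := p *m N *m p^T == 0.

Definition polar N p : 'rV[R]_3 := p *m N.

Definition is_center N p : bool := (polar N p == linf)%MS.

(* image of N under the map p |-> p *m M *)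
Definition conic_image M N : 'M[R]_3 := invmx M *m N *m (invmx M)^T.

Definition nine_points (a b c d : 'rV[R]_3) : seq 'rV[R]_3 :=
  [:: inter (line a b) (line c d); inter (line a c) (line b d);
      inter (line a d) (line b c);
      midpoint a b; midpoint a c; midpoint a d;
      midpoint b c; midpoint b d; midpoint c d].

Definition nine_point_conic (a b c d : 'rV[R]_3) N : bool :=
  conic N && all (on_conic N) (nine_points a b c d).

Definition off_sides (a b c p : 'rV[R]_3) : bool :=
  [&& ~~ on p (line b c), ~~ on p (line c a) & ~~ on p (line a b)].

Definition anticevian (a b c q qa qb qc : 'rV[R]_3) : bool :=
  [&& (a == inter (line qb qc) (line q qa))%MS,
      (b == inter (line qa qc) (line q qb))%MS &
      (c == inter (line qa qb) (line q qc))%MS].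

End ExtendedPlane.

Arguments linf {R}.

Section Triangle.
Variables (R : realFieldType) (A B C : 'rV[R]_2).
Implicit Types (P D E F O H V : 'rV[R]_3) (M : 'M[R]_3).

Definition triangle : bool := ~~ on (ordpt A) (line (ordpt B) (ordpt C)).

Definition centroid : 'rV[R]_2 := 3%:R^-1 *: (A + B + C).

Definition complement : 'M[R]_3 := homothety centroid (- 2%:R^-1).

Definition mid (X Y : 'rV[R]_2) : 'rV[R]_2 := 2%:R^-1 *: (X + Y).

Definition trace_a P := inter (line (ordpt A) P) (line (ordpt B) (ordpt C)).
Definition trace_b P := inter (line (ordpt B) P) (line (ordpt C) (ordpt A)).
Definition trace_c P := inter (line (ordpt C) P) (line (ordpt A) (ordpt B)).

Definition refl_trace_a P := trace_a P *m point_reflection (mid B C).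
Definition refl_trace_b P := trace_b P *m point_reflection (mid C A).
Definition refl_trace_c P := trace_c P *m point_reflection (mid A B).

Definition isotomic P P' : bool :=
  [&& P' != 0, on P' (line (ordpt A) (refl_trace_a P)),
      on P' (line (ordpt B) (refl_trace_b P)) &
      on P' (line (ordpt C) (refl_trace_c P))].

(* This image of the line at infinity is the Steiner circumellipse. *)
Definition on_iota_linf P : Prop :=
  exists X : 'rV[R]_3, [/\ X != 0, on X linf & isotomic X P].

Definition on_median P : bool :=
  [|| on P (line (ordpt A) (ordpt (mid B C))),
      on P (line (ordpt B) (ordpt (mid C A))) |
      on P (line (ordpt C) (ordpt (mid A B)))].

Definition affine_taking D E F M : bool :=
  [&& affine M, (ordpt A *m M == D)%MS, (ordpt B *m M == E)%MS &
      (ordpt C *m M == F)%MS].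

Definition gen_circumcenter Q D E F O : bool :=
  [&& O != 0, join_parallel O (ordpt (mid B C)) (line Q D),
      join_parallel O (ordpt (mid C A)) (line Q E) &
      join_parallel O (ordpt (mid A B)) (line Q F)].

Definition gen_orthocenter Q D E F H : bool :=
  [&& H != 0, join_parallel H (ordpt A) (line Q D),
      join_parallel H (ordpt B) (line Q E) &
      join_parallel H (ordpt C) (line Q F)].

(* The affine reflection eta. Its direction is only tested on ordinary points,    *)
(* since two points at infinity are always joined by the line at infinity.    *)
Definition eta_reflection P P' V M : Prop :=
  [/\ affine M,
      forall p : 'rV[R]_3, p != 0 -> on p (line (ordpt centroid) V) ->
        (p *m M == p)%MS,
      (P *m M == P')%MS /\ (P' *m M == P)%MS &
      forall X : 'rV[R]_2, join_parallel (ordpt X) (ordpt X *m M) (line P P')].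

End Triangle.

(* Main.v *)
(* In barycentric coordinates write P' = (p : q : r), so that                 *)
(* P = (qr : rp : pq), and let u = q + r, v = r + p, w = p + q; then          *)
(* Q = (u : v : w). The nine points impose on N linear conditions whose       *)
(* solutions are the multiples of                                             *)
(*   qr X^2 + rp Y^2 + pq Z^2 - pu YZ - qv ZX - rw XY,                        *)
(* and the pull-back of this conic by T is, up to a factor, the circumconic   *)
(*   u^2 YZ + v^2 ZX + w^2 XY.                                                *)
(* Thus O and H have the coordinates of the circumcenter and the orthocenter  *)
(* of a triangle with side lengths u, v, w, and (a) and (b) are polynomial    *)
(* identities. For (c), O and H are combinations of G, P and P' whose         *)
(* coefficients are symmetric in p, q, r; the map eta fixes G and swaps P     *)
(* and P', and replacing (p, q, r) by (qr, rp, pq) has the same effect on     *)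
(* these combinations.                                                        *)

Require Import Defs.
From mathcomp Require Import all_boot all_order all_algebra.
From mathcomp Require Import ring.

Set Implicit Arguments.
Unset Strict Implicit.
Unset Printing Implicit Defensive.

Import Order.TTheory GRing.Theory Num.Theory.
Local Open Scope ring_scope.

(** Everything is computed in homogeneous barycentric coordinates, and the parameters [p], [q], [r]
    have a classical model. If they are positive, some triangle has sides [u], [v], [w], and [p],
    [q], [r] are its semiperimeter minus each side. There P and P' are the Gergonne and Nagel
    points, Q is the incenter, D, E, F are the contact points of the incircle, and the anticevian
    triangle of Q is the excentral triangle. Since QD is then perpendicular to BC, O and H are the
    usual circumcenter and orthocenter, and the circumconic is the circumcircle, which is the
    nine-point circle of the incenter and the excenters. The resulting formulas are polynomial, and
    they are verified here for parameters of any sign.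

    Parts (a) and (b) rest on [nine_point_conic_bary], which determines the conic, on
    [circumconic_bary], which pulls it back, and on [anticevian_bary]. For (c),
    [gen_circumcenter_eq] and [gen_orthocenter_eq] show that the parallelisms determine O and H. The
    images under eta come from [circumcenter_swap] and [orthocenter_swap]. The parallels to PP' come
    from the shift lemmas instead, because no eta exists when P is at infinity and P' is not. *)

(** * Homogeneous coordinates, bilinear forms and parallelism *)

Section Coordinates.
Variable R : realFieldType.
Implicit Types (X Y : 'rV[R]_2) (p q l m u v : 'rV[R]_3) (M N : 'M[R]_3).

Lemma row3P u v :
  u 0 0 = v 0 0 -> u 0 1 = v 0 1 -> u 0 2%:R = v 0 2%:R -> u = v.
Proof.
move=> h0 h1 h2; apply/rowP => -[[|[|[|//]]] i].
- by rewrite (_ : Ordinal i = 0) //; apply: val_inj.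
- by rewrite (_ : Ordinal i = 1) //; apply: val_inj.
- by rewrite (_ : Ordinal i = 2%:R) //; apply: val_inj.
Qed.

Lemma sum3 (f : 'I_3 -> R) : \sum_i f i = f 0 + f 1 + f 2%:R.
Proof.
rewrite !big_ord_recl big_ord0 addr0 addrA.
by congr (_ + f _ + f _); apply: val_inj.
Qed.

Definition dot u v : R := (u *m v^T) 0 0.

Lemma dotE u v : dot u v = u 0 0 * v 0 0 + u 0 1 * v 0 1 + u 0 2%:R * v 0 2%:R.
Proof. by rewrite /dot mxE sum3 !mxE. Qed.

Lemma onE p l : on p l = (dot p l == 0).
Proof.
apply/eqP/eqP => h; first by rewrite /dot h mxE.
by apply/matrixP => i j; rewrite !ord1 [RHS]mxE; exact: h.
Qed.

Lemma crossE u v :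
  ((cross u v 0 0 = u 0 1 * v 0 2%:R - u 0 2%:R * v 0 1) *
   (cross u v 0 1 = u 0 2%:R * v 0 0 - u 0 0 * v 0 2%:R) *
   (cross u v 0 2%:R = u 0 0 * v 0 1 - u 0 1 * v 0 0))%type.
Proof.
split; [split|]; rewrite mxE;
  by congr (u 0 _ * v 0 _ - u 0 _ * v 0 _); apply: val_inj.
Qed.

Lemma ordptE X :
  ((ordpt X 0 0 = X 0 0) * (ordpt X 0 1 = X 0 1) * (ordpt X 0 2%:R = 1))%type.
Proof.
rewrite /ordpt; split; [split|].
- by rewrite -(row_mxEl X (1%:M : 'M[R]_1)); congr (_ 0 _); apply: val_inj.
- by rewrite -(row_mxEl X (1%:M : 'M[R]_1)); congr (_ 0 _); apply: val_inj.
- transitivity ((1%:M : 'M[R]_1) 0 0); last by rewrite mxE.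
  by rewrite -(row_mxEr X (1%:M : 'M[R]_1)); congr (_ 0 _); apply: val_inj.
Qed.

Lemma linfE :
  ((linf 0 0 = 0 :> R) * (linf 0 1 = 0 :> R) * (linf 0 2%:R = 1 :> R))%type.
Proof. by rewrite -/(ordpt 0) !ordptE !mxE. Qed.

Definition coordE := (ordptE, linfE, crossE, dotE, mxE).

Lemma weightE p : weight p = p 0 2%:R.
Proof. by congr (p 0 _); apply: val_inj. Qed.

Lemma proj_eqP u v :
  reflect (exists2 k : R, k != 0 & u = k *: v) (u == v)%MS.
Proof.
apply: (iffP andP) => [[/sub_rVP[k ->] /sub_rVP[j vE]]|[k k0 ->]]; last first.
  by rewrite !eqmx_scale.
have [v0|v0] := eqVneq v 0; first by exists 1; rewrite ?oner_eq0 // v0 !scaler0.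
by exists k => //; apply: contraNneq v0 => k0; rewrite vE k0 !scale0r scaler0.
Qed.

Lemma crossZl k u v : cross (k *: u) v = k *: cross u v.
Proof. by apply: row3P; rewrite [RHS]mxE !crossE !mxE; ring. Qed.

Lemma crossZr k u v : cross u (k *: v) = k *: cross u v.
Proof. by apply: row3P; rewrite [RHS]mxE !crossE !mxE; ring. Qed.

Lemma dotZl k u v : dot (k *: u) v = k * dot u v.
Proof. by rewrite /dot -scalemxAl mxE. Qed.

Lemma dotZr k u v : dot u (k *: v) = k * dot u v.
Proof. by rewrite /dot linearZ -scalemxAr mxE. Qed.

Lemma dot_crossl u v : dot u (cross u v) = 0.
Proof. by rewrite dotE !crossE; ring. Qed.

Lemma dot_crossr u v : dot v (cross u v) = 0.
Proof. by rewrite dotE !crossE; ring. Qed.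

Lemma cross_self u : cross u u = 0.
Proof. by apply: row3P; rewrite [RHS]mxE !crossE; ring. Qed.

Lemma weight_linf p : weight p = dot p linf.
Proof. by rewrite weightE dotE !linfE; ring. Qed.

Lemma weight_affine M p : affine M -> weight (p *m M) = weight p.
Proof. by case/andP=> _ /eqP e; rewrite !weight_linf /dot -mulmxA e. Qed.

Definition bilin M u v : R := (u *m M *m v^T) 0 0.

Lemma on_conicE M p : on_conic M p = (bilin M p p == 0).
Proof.
apply/eqP/eqP => h; first by rewrite /bilin h mxE.
by apply/matrixP => i j; rewrite !ord1 [RHS]mxE; exact: h.
Qed.

Lemma bilinDl M u u' v : bilin M (u + u') v = bilin M u v + bilin M u' v.
Proof. by rewrite /bilin !mulmxDl mxE. Qed.

Lemma bilinZl M k u v : bilin M (k *: u) v = k * bilin M u v.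
Proof. by rewrite /bilin -!scalemxAl mxE. Qed.

Lemma bilinDr M u v v' : bilin M u (v + v') = bilin M u v + bilin M u v'.
Proof. by rewrite /bilin linearD mulmxDr mxE. Qed.

Lemma bilinZr M k u v : bilin M u (k *: v) = k * bilin M u v.
Proof. by rewrite /bilin linearZ -scalemxAr mxE. Qed.

Lemma bilinC M u v : M^T = M -> bilin M u v = bilin M v u.
Proof.
move=> sM; rewrite /bilin; transitivity ((u *m M *m v^T)^T 0 0).
  by rewrite [RHS]mxE.
by rewrite !trmx_mul trmxK sM mulmxA.
Qed.

Lemma bilin_conic_image M N u v :
  bilin (conic_image (invmx M) N) u v = bilin N (u *m M) (v *m M).
Proof. by rewrite /bilin /conic_image invmxK trmx_mul !mulmxA. Qed.

(* Parallelism to l forces the line pq through the point of l at infinity. *)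
Lemma join_parallel_on p q l :
  join_parallel p q l -> dot (inter l linf) (line p q) = 0.
Proof.
case/orP => [/proj_eqP[k _ ->]|/proj_eqP[k k0 e]].
  by rewrite /line crossZl cross_self scaler0 /dot trmx0 mulmx0 mxE.
have := dot_crossl (line p q) linf; rewrite -/(inter _ _) e dotZr.
move/eqP; rewrite mulf_eq0 (negPf k0) /= => /eqP <-.
by rewrite !dotE; ring.
Qed.

(** Adding a multiple of the infinite point of [l] to an ordinary point moves it along a parallel to
    [l]. The case [j = 0], where the target is that infinite point itself, is included. *)
Lemma join_parallel_shift p d l i j :
    weight p != 0 -> j *: p + i *: d != 0 -> (inter l linf == d)%MS ->
  join_parallel p (j *: p + i *: d) l.
Proof.
move=> wp q0 /proj_eqP[k k0 e].
have wd : weight d = 0.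
  have := dot_crossr l linf; rewrite -/(inter _ _) e dotZr => /eqP.
  by rewrite mulf_eq0 (negPf k0) /= weight_linf => /eqP <-; rewrite !dotE; ring.
have [i0|i0] := eqVneq i 0.
  move: q0; rewrite i0 scale0r addr0 => q0; apply/orP; left; apply/proj_eqP.
  have j0 : j != 0 by apply: contraNneq q0 => ->; rewrite scale0r.
  by exists j^-1; rewrite ?invr_eq0 // scalerA mulVf // scale1r.
(* As [d] has weight 0, the triple product of [p], [d] and [linf] is [weight p] times [d], while
   [inter l linf] is [k] times [d]. *)
apply/orP; right; apply/proj_eqP; exists (i * weight p / k).
  by rewrite !mulf_neq0 ?invr_eq0.
rewrite e scalerA divfK // /inter /line; move: wd; rewrite !weightE => wd.
by apply: row3P; rewrite [RHS]mxE !crossE !linfE !mxE wd; ring.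
Qed.

End Coordinates.

(** * Barycentric coordinates for points, lines, traces and conics *)

Section Barycentric.
Variables (R : realFieldType) (A B C : 'rV[R]_2).
Implicit Types (x y z l m n : R) (u v : 'rV[R]_3) (M N : 'M[R]_3).

Local Notation a := (ordpt A).
Local Notation b := (ordpt B).
Local Notation c := (ordpt C).

Definition bary x y z : 'rV[R]_3 := x *: a + y *: b + z *: c.

(* The line l X + m Y + n Z = 0 in barycentric coordinates; the basis used is *)
(* dual to (a, b, c) only up to the factor det_abc.                           *)
Definition baryl l m n : 'rV[R]_3 :=
  l *: cross b c + m *: cross c a + n *: cross a b.

Definition det_abc : R := dot a (cross b c).

Local Notation pt := bary.
Local Notation ln := baryl.
Local Notation d := det_abc.

Lemma ordptA : a = pt 1 0 0.
Proof. by rewrite /pt scale1r !scale0r !addr0. Qed.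

Lemma ordptB : b = pt 0 1 0.
Proof. by rewrite /pt scale1r !scale0r add0r addr0. Qed.

Lemma ordptC : c = pt 0 0 1.
Proof. by rewrite /pt scale1r !scale0r !add0r. Qed.

Lemma baryZ k x y z : k *: pt x y z = pt (k * x) (k * y) (k * z).
Proof. by rewrite /pt !scalerDr !scalerA. Qed.

Lemma baryD x y z x' y' z' :
  pt x y z + pt x' y' z' = pt (x + x') (y + y') (z + z').
Proof. by rewrite /pt !scalerDl addrACA (addrACA (x *: _)). Qed.

Lemma weight_bary x y z : weight (pt x y z) = x + y + z.
Proof. by rewrite weightE /pt !coordE; ring. Qed.

Lemma cross_bary x y z x' y' z' : cross (pt x y z) (pt x' y' z') =
  ln (y * z' - z * y') (z * x' - x * z') (x * y' - y * x').
Proof. by apply: row3P; rewrite /pt /ln /d !coordE; ring. Qed.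

Lemma cross_baryl l m n l' m' n' : cross (ln l m n) (ln l' m' n') =
  pt (d * (m * n' - n * m')) (d * (n * l' - l * n')) (d * (l * m' - m * l')).
Proof.
by apply: row3P; rewrite /pt /ln /d !coordE; ring.
Qed.

Lemma dot_bary x y z l m n :
  dot (pt x y z) (ln l m n) = d * (x * l + y * m + z * n).
Proof. by rewrite /d /pt /ln !coordE; ring. Qed.

Lemma bary_homothety G k x y z : pt x y z *m homothety G k =
  k *: pt x y z + ((1 - k) * (x + y + z)) *: ordpt G.
Proof.
have e X : ordpt X *m homothety G k = k *: ordpt X + (1 - k) *: ordpt G.
  rewrite [LHS](mul_row_block X 1%:M k%:M 0 ((1 - k) *: G) 1%:M).
  rewrite mulmx0 add0r mulmx1 mul_mx_scalar mul1mx -/(ordpt _).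
  by apply: row3P; rewrite !coordE; ring.
rewrite /pt !mulmxDl -!scalemxAl !e; apply: row3P; rewrite !mxE; ring.
Qed.

Lemma centroid_bary : ordpt (centroid A B C) = pt 3%:R^-1 3%:R^-1 3%:R^-1.
Proof. by apply: row3P; rewrite /pt !coordE; field. Qed.

Lemma complement_bary x y z : pt x y z *m complement A B C =
  pt ((y + z) / 2%:R) ((z + x) / 2%:R) ((x + y) / 2%:R).
Proof.
rewrite bary_homothety centroid_bary !baryZ baryD.
by congr pt; field.
Qed.

Lemma complement_unit : complement A B C \in unitmx.
Proof.
have e (x : R) : x%:M *m (x^-1)%:M = (x * x^-1)%:M :> 'M_2.
  by rewrite scalar_mxM.
suff /mulmx1_unit[] :
  complement A B C *m homothety (centroid A B C) (- 2%:R^-1)^-1 = 1%:M by [].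
set G := centroid A B C; set k := - 2%:R^-1.
rewrite [LHS](mulmx_block k%:M 0 ((1 - k) *: G) 1%:M
  k^-1%:M 0 ((1 - k^-1) *: G) 1%:M).
rewrite !mulmx0 !mul0mx !addr0 add0r mulmx1 e.
rewrite mulfV /k ?oppr_eq0 ?invr_eq0 ?pnatr_eq0 //.
rewrite mul_mx_scalar mul1mx scalerA -scalerDl.
rewrite [X in X *: _](_ : _ = 0) ?scale0r; last by field.
by rewrite -scalar_mx_block.
Qed.

Lemma mid_bary :
  ((ordpt (mid B C) = pt 0 2%:R^-1 2%:R^-1) *
   (ordpt (mid C A) = pt 2%:R^-1 0 2%:R^-1) *
   (ordpt (mid A B) = pt 2%:R^-1 2%:R^-1 0))%type.
Proof. by split; [split|]; apply: row3P; rewrite /pt !coordE; field. Qed.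

Hypothesis abc : triangle A B C.

Lemma det_abc_neq0 : d != 0.
Proof. by move: abc; rewrite /triangle onE. Qed.

Lemma baryP u : exists x y z, u = pt x y z.
Proof.
(* Cramer's rule in the basis [a], [b], [c]. *)
have d0 := det_abc_neq0; exists (dot u (cross b c) / d).
exists (dot u (cross c a) / d), (dot u (cross a b) / d).
apply: (scalerI d0); rewrite baryZ ![d * _]mulrC !divfK //.
by apply: row3P; rewrite /pt /d !coordE; ring.
Qed.

Lemma on_bary x y z l m n :
  on (pt x y z) (ln l m n) = (x * l + y * m + z * n == 0).
Proof. by rewrite onE dot_bary mulf_eq0 (negPf det_abc_neq0). Qed.

Lemma bary_eq0 x y z : (pt x y z == 0) = [&& x == 0, y == 0 & z == 0].
Proof.
apply/eqP/and3P => [e|[/eqP-> /eqP-> /eqP->]]; last first.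
  by rewrite /pt !scale0r !addr0.
have h l m n : x * l + y * m + z * n == 0.
  by rewrite -on_bary e /on mul0mx.
have := (h 1 0 0, h 0 1 0, h 0 0 1).
by rewrite !mulr0 !mulr1 !addr0 !add0r => -[[-> ->] ->].
Qed.

Lemma linf_bary : linf = ln d^-1 d^-1 d^-1.
Proof.
apply: (scalerI det_abc_neq0); rewrite /ln -!scalerDr scalerA.
rewrite divff ?det_abc_neq0 // scale1r.
by apply: row3P; rewrite /ln /d !coordE; ring.
Qed.

Lemma inter_linf l m n : inter (ln l m n) linf = pt (m - n) (n - l) (l - m).
Proof.
rewrite linf_bary /inter cross_baryl.
by congr pt; field; rewrite det_abc_neq0.
Qed.

Lemma trace_a_bary x y z : trace_a A B C (pt x y z) = pt 0 (d * y) (d * z).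
Proof.
rewrite /trace_a /line /inter ordptA ordptB ordptC !cross_bary cross_baryl.
by congr pt; ring.
Qed.

Lemma trace_b_bary x y z : trace_b A B C (pt x y z) = pt (d * x) 0 (d * z).
Proof.
rewrite /trace_b /line /inter ordptA ordptB ordptC !cross_bary cross_baryl.
by congr pt; ring.
Qed.

Lemma trace_c_bary x y z : trace_c A B C (pt x y z) = pt (d * x) (d * y) 0.
Proof.
rewrite /trace_c /line /inter ordptA ordptB ordptC !cross_bary cross_baryl.
by congr pt; ring.
Qed.

Lemma refl_trace_a_bary x y z :
  refl_trace_a A B C (pt x y z) = pt 0 (d * z) (d * y).
Proof.
rewrite /refl_trace_a trace_a_bary bary_homothety mid_bary !baryZ baryD.
by congr pt; field.
Qed.

Lemma refl_trace_b_bary x y z :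
  refl_trace_b A B C (pt x y z) = pt (d * z) 0 (d * x).
Proof.
rewrite /refl_trace_b trace_b_bary bary_homothety mid_bary !baryZ baryD.
by congr pt; field.
Qed.

Lemma refl_trace_c_bary x y z :
  refl_trace_c A B C (pt x y z) = pt (d * y) (d * x) 0.
Proof.
rewrite /refl_trace_c trace_c_bary bary_homothety mid_bary !baryZ baryD.
by congr pt; field.
Qed.

Lemma isotomic_bary x y z p q r :
  isotomic A B C (pt x y z) (pt p q r) =
  [&& pt p q r != 0, y * q == z * r, z * r == x * p & x * p == y * q].
Proof.
have h (s t k : R) : k = d * (t - s) -> (k == 0) = (s == t).
  by move->; rewrite mulf_eq0 (negPf det_abc_neq0) /= subr_eq0 eq_sym.
rewrite /isotomic refl_trace_a_bary refl_trace_b_bary refl_trace_c_bary.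
rewrite {1}ordptA {1}ordptB {1}ordptC /line !cross_bary !on_bary.
congr andb; congr andb; [|congr andb];
  by rewrite -[RHS](h _ _ _ erefl); congr (_ == _); ring.
Qed.

Lemma off_sides_bary x y z :
  off_sides a b c (pt x y z) = [&& x != 0, y != 0 & z != 0].
Proof.
rewrite /off_sides ordptA ordptB ordptC /line !cross_bary !on_bary.
by rewrite !(mul0r, mulr0, mul1r, mulr1, subr0, sub0r, add0r, addr0, oppr0).
Qed.

Lemma off_anticomplementary_bary x y z :
  let K := complement A B C in
  off_sides (a *m invmx K) (b *m invmx K) (c *m invmx K) (pt x y z) =
  [&& y + z != 0, z + x != 0 & x + y != 0].
Proof.
move=> K.
have e p q r x' y' z' :
    pt p q r = pt x' y' z' *m K -> pt p q r *m invmx K = pt x' y' z'.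
  by move->; rewrite mulmxK ?complement_unit.
rewrite ordptA ordptB ordptC.
rewrite (e 1 0 0 (-1) 1 1); last by rewrite complement_bary; congr pt; field.
rewrite (e 0 1 0 1 (-1) 1); last by rewrite complement_bary; congr pt; field.
rewrite (e 0 0 1 1 1 (-1)); last by rewrite complement_bary; congr pt; field.
rewrite /off_sides /line !cross_bary !on_bary.
have h (t : R) : (2%:R * t == 0) = (t == 0) by rewrite mulf_eq0 pnatr_eq0.
rewrite -(h (y + z)) -(h (z + x)) -(h (x + y)).
by congr andb; [|congr andb]; congr negb; congr (_ == _); ring.
Qed.

Lemma bilin_bary M x y z x' y' z' : M^T = M ->
  bilin M (pt x y z) (pt x' y' z') =
  x * x' * bilin M a a + y * y' * bilin M b b + z * z' * bilin M c c
  + (y * z' + z * y') * bilin M b c + (z * x' + x * z') * bilin M c a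
  + (x * y' + y * x') * bilin M a b.
Proof.
move=> sM; rewrite /pt !(bilinDl, bilinDr, bilinZl, bilinZr).
by rewrite (bilinC c b) // (bilinC a c) // (bilinC b a) //; ring.
Qed.

Lemma dot_abc_eq0 u : dot u a = 0 -> dot u b = 0 -> dot u c = 0 -> u = 0.
Proof.
have dC v w : dot v w = dot w v by rewrite !dotE; ring.
have dD v w t : dot v (w + t) = dot v w + dot v t by rewrite !coordE; ring.
move=> ha hb hc.
have h v : dot u v = 0.
  have [x [y [z ->]]] := baryP v.
  by rewrite /pt !(dD, dotZr) ha hb hc; ring.
by apply: row3P; rewrite [RHS]mxE;
  [rewrite -(h (\row_j (j == 0)%:R)) | rewrite -(h (\row_j (j == 1)%:R))
  | rewrite -(h (\row_j (j == 2%:R)%:R))]; rewrite !coordE /=; ring.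
Qed.

(** The line [linf] pairs to 1 with every [ordpt], and a linear form is determined by its values at
    the vertices. This turns the test for a center into three scalar equations. *)
Lemma polar_bary M u k :
    bilin M u a = k -> bilin M u b = k -> bilin M u c = k ->
  polar M u = k *: linf.
Proof.
move=> ha hb hc; apply/eqP; rewrite -subr_eq0; apply/eqP.
have h X : dot (polar M u - k *: linf) (ordpt X) = bilin M u (ordpt X) - k.
  have dB v w t : dot (v - w) t = dot v t - dot w t by rewrite !coordE; ring.
  have l1 : dot linf (ordpt X) = 1 by rewrite !coordE; ring.
  by rewrite dB dotZl l1 mulr1.
by apply: dot_abc_eq0; rewrite h (ha, hb, hc) subrr.
Qed.

Lemma midpoint_bary x y z x' y' z' :
  midpoint (pt x y z) (pt x' y' z') =
  pt ((x' + y' + z') * x + (x + y + z) * x')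
     ((x' + y' + z') * y + (x + y + z) * y')
     ((x' + y' + z') * z + (x + y + z) * z').
Proof. by rewrite /midpoint !weight_bary !baryZ baryD. Qed.

Lemma bilin_abc_eq0 M : M^T = M ->
    bilin M a a = 0 -> bilin M b b = 0 -> bilin M c c = 0 ->
    bilin M b c = 0 -> bilin M c a = 0 -> bilin M a b = 0 -> M = 0.
Proof.
move=> sM ha hb hc hbc hca hab; apply/row_matrixP => i; rewrite row0 rowE.
have [x [y [z ->]]] := baryP (delta_mx 0 i).
rewrite -/(polar _ _) (polar_bary (k := 0)) ?scale0r //.
- by rewrite [X in bilin _ _ X]ordptA bilin_bary // ha hb hc hbc hca hab; ring.
- by rewrite [X in bilin _ _ X]ordptB bilin_bary // ha hb hc hbc hca hab; ring.
- by rewrite [X in bilin _ _ X]ordptC bilin_bary // ha hb hc hbc hca hab; ring.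
Qed.

End Barycentric.

(** * The nine-point conic of ABCP' *)

Section NinePointConics.
Variables (R : realFieldType) (A B C : 'rV[R]_2).
Implicit Types (x y z p q r u v w k : R) (M N : 'M[R]_3).
Hypothesis abc : triangle A B C.

Local Notation a := (ordpt A).
Local Notation b := (ordpt B).
Local Notation c := (ordpt C).
Local Notation pt := (bary A B C).
Local Notation d := (det_abc A B C).

Lemma bilin_vertices M x y z : M^T = M ->
  ((bilin M (pt x y z) a =
      (x * bilin M a a + y * bilin M a b + z * bilin M c a)%R) *
   (bilin M (pt x y z) b =
      (x * bilin M a b + y * bilin M b b + z * bilin M b c)%R) *
   (bilin M (pt x y z) c =
      (x * bilin M c a + y * bilin M b c + z * bilin M c c)%R))%type.
Proof.
move=> sM; split; [split|].
- by rewrite [X in bilin _ _ X](ordptA A B C) bilin_bary //; ring.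
- by rewrite [X in bilin _ _ X](ordptB A B C) bilin_bary //; ring.
- by rewrite [X in bilin _ _ X](ordptC A B C) bilin_bary //; ring.
Qed.

(** The midpoints of BC, CA, AB express the mixed entries of [N] through the diagonal ones. The
    other six points then make [p * al], [q * be] and [r * ga] equal, which leaves one free
    scalar. *)
Lemma nine_point_conic_bary p q r N :
    p != 0 -> q != 0 -> r != 0 ->
    q + r != 0 -> r + p != 0 -> p + q != 0 ->
    nine_point_conic a b c (pt p q r) N ->
  exists2 t, t != 0 &
    [/\ N^T = N,
        [/\ bilin N a a = 2%:R * t * q * r, bilin N b b = 2%:R * t * r * p
          & bilin N c c = 2%:R * t * p * q] &
        [/\ bilin N b c = - (t * p * (q + r)), bilin N c a = - (t * q * (r + p))
          & bilin N a b = - (t * r * (p + q))]].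
Proof.
move=> p0 q0 r0 qr0 rp0 pq0 /andP[/andP[/eqP sN N0]].
have d0 := det_abc_neq0 abc.
rewrite /nine_points /inter /line /=.
rewrite (ordptA A B C) (ordptB A B C) (ordptC A B C).
rewrite !cross_bary !cross_baryl !midpoint_bary !on_conicE !bilin_bary //.
have two0 : 2%:R != 0 :> R by rewrite pnatr_eq0.
move: (bilin N a a) (bilin N b b) (bilin N c c) (bilin N b c) (bilin N c a)
  (bilin N a b) (bilin_abc_eq0 abc sN) => al be ga f g h nz.
case/and5P => /eqP hF3 /eqP hE3 /eqP hD3 /eqP hF0.
case/and5P => /eqP hE0 /eqP hMa /eqP hD0 /eqP hMb /andP[/eqP hMc _].
have cancel k s t : k != 0 -> k * s = t -> t = 0 -> s = 0.
  by move=> k0 e t0; apply: (mulfI k0); rewrite e t0 mulr0.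
have fE : f = - ((be + ga) / 2%:R).
  apply/eqP; rewrite -subr_eq0; apply/eqP.
  apply: (cancel 2%:R _ _ _ _ hD0) => //.
  by field.
have gE : g = - ((ga + al) / 2%:R).
  apply/eqP; rewrite -subr_eq0; apply/eqP.
  apply: (cancel 2%:R _ _ _ _ hE0) => //.
  by field.
have hE : h = - ((al + be) / 2%:R).
  apply/eqP; rewrite -subr_eq0; apply/eqP.
  apply: (cancel 2%:R _ _ _ _ hF0) => //.
  by field.
subst f g h.
(* The condition at the diagonal point (0 : q : r) factors, and it is empty when P' lies on the
   median from A. The midpoints of AP', BP', CP' cover the cases that [kD], [kE], [kF] leave
   open. *)
have kD : (q - r) * (q * be - r * ga) = 0.
  by apply: (cancel (d * d) _ _ _ _ hD3); [rewrite mulf_neq0 | field].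
have kE : (r - p) * (r * ga - p * al) = 0.
  by apply: (cancel (d * d) _ _ _ _ hE3); [rewrite mulf_neq0 | field].
have kF : (p - q) * (p * al - q * be) = 0.
  by apply: (cancel (d * d) _ _ _ _ hF3); [rewrite mulf_neq0 | field].
have kA : (p + r) * (p * al - q * be) + (p + q) * (p * al - r * ga) = 0.
  by apply: (cancel 2%:R _ _ _ _ hMa); [| field].
have kB : (q + p) * (q * be - r * ga) + (q + r) * (q * be - p * al) = 0.
  by apply: (cancel 2%:R _ _ _ _ hMb); [| field].
have kC : (r + q) * (r * ga - p * al) + (r + p) * (r * ga - q * be) = 0.
  by apply: (cancel 2%:R _ _ _ _ hMc); [| field].
have cut (s t : R) : s != 0 -> s * t = 0 -> t = 0.
  by move=> s0 st0; apply: (cancel s t 0).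
have [X0 Y0] : p * al - q * be = 0 /\ p * al - r * ga = 0.
  have [pq|pq] := eqVneq p q; last first.
    have X0 : p * al - q * be = 0 by apply: cut kF; rewrite subr_eq0.
    by split=> //; apply: cut pq0 _; rewrite -kA X0 mulr0 add0r.
  have [rp|rp] := eqVneq r p; last first.
    have Y0 : p * al - r * ga = 0.
      by rewrite -opprB (cut _ _ _ kE) ?oppr0 // subr_eq0.
    by split=> //; apply: cut rp0 _; rewrite -kA Y0 mulr0 addr0 addrC.
  (* Here [p = q = r], so P' is the centroid and all three diagonal conditions are empty. *)
  have X0 : p * al - q * be = 0.
    apply: (cut (6%:R * p)); first by rewrite mulf_neq0 ?pnatr_eq0.
    transitivity (((p + r) * (p * al - q * be) + (p + q) * (p * al - r * ga)) -
      ((q + p) * (q * be - r * ga) + (q + r) * (q * be - p * al))).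
      by rewrite rp -pq; ring.
    by rewrite kA kB subr0.
  by split=> //; apply: cut pq0 _; rewrite -kA X0 mulr0 add0r.
have alE : al = (p * al) / p by field.
have beE : be = (p * al) / q by rewrite -[p * al]subr0 -X0; field.
have gaE : ga = (p * al) / r by rewrite -[p * al]subr0 -Y0; field.
exists (p * al / (2%:R * p * q * r)); last first.
  by split=> //; split; rewrite ?beE ?gaE; field; rewrite ?p0 ?q0 ?r0.
rewrite mulf_neq0 ?invr_eq0 ?mulf_neq0 //.
apply: contraNneq N0 => al0; apply/eqP; apply: nz => //;
  rewrite ?beE ?gaE ?al0; ring.
Qed.

End NinePointConics.

(** * The center of the nine-point conic, anticevian triangles and the circumconic *)

Section Circumconic.
Variables (R : realFieldType) (A B C : 'rV[R]_2).
Implicit Types (x y z p q r u v w k t : R) (M N T : 'M[R]_3).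
Hypothesis abc : triangle A B C.

Local Notation a := (ordpt A).
Local Notation b := (ordpt B).
Local Notation c := (ordpt C).
Local Notation pt := (bary A B C).
Local Notation d := (det_abc A B C).

Lemma is_center_bary M (m : 'rV[R]_3) k : k != 0 ->
  bilin M m a = k -> bilin M m b = k -> bilin M m c = k -> is_center M m.
Proof.
move=> k0 ha hb hc; apply/proj_eqP; exists k => //.
exact: (polar_bary abc).
Qed.

(** Affine maps preserve weights, so an image known only up to a factor is known as a vector. *)
Lemma affine_image (f g : 'rV[R]_3) T : affine T -> weight g != 0 ->
  (f *m T == g)%MS -> f *m T = (weight f / weight g) *: g.
Proof.
move=> aT g0 /proj_eqP[k k0 e]; rewrite e; congr (_ *: _).
by rewrite -(weight_affine f aT) e [weight (k *: g)]weightE mxE -weightE mulfK.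
Qed.

Lemma nine_point_conic_center p q r N :
    p != 0 -> q != 0 -> r != 0 ->
    q + r != 0 -> r + p != 0 -> p + q != 0 ->
    nine_point_conic a b c (pt p q r) N ->
  is_center N (pt p q r *m complement A B C *m complement A B C).
Proof.
move=> p0 q0 r0 qr0 rp0 pq0 nN.
have [t t0 [sN [Naa Nbb Ncc] [Nbc Nca Nab]]] :=
  nine_point_conic_bary abc p0 q0 r0 qr0 rp0 pq0 nN.
rewrite !complement_bary.
apply: (is_center_bary (k := - (t * (q + r) * (r + p) * (p + q) / 4%:R)));
  rewrite ?(bilin_vertices _ _ _ _ _ _ sN)
    ?Naa ?Nbb ?Ncc ?Nbc ?Nca ?Nab; try by field.
by rewrite oppr_eq0 !mulf_neq0 // invr_eq0 pnatr_eq0.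
Qed.

Lemma dot_inter_eq0 (m l l' : 'rV[R]_3) : (m == inter l l')%MS ->
  dot m l = 0 /\ dot m l' = 0.
Proof.
case/proj_eqP=> k k0 ->; rewrite !dotZl.
by split; rewrite [dot _ _](_ : _ = 0) ?mulr0 // /inter !coordE; ring.
Qed.

(** This excludes vertices of an anticevian triangle that coincide with Q or are null vectors. *)
Lemma line_neq0 (m l f g : 'rV[R]_3) :
  m != 0 -> (m == inter l (line f g))%MS -> line f g != 0.
Proof.
move=> m0 /proj_eqP[k k0 e]; apply: contraNneq m0 => l0.
rewrite e l0 [inter _ _](_ : _ = 0) ?scaler0 //.
by apply: row3P; rewrite /inter !coordE; ring.
Qed.

(* In the next three lemmas the vertices of an anticevian triangle of         *)
(* (u : v : w) are (x : iv : iw), (ju : y : jw) and (ku : kv : z), as they    *)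
(* lie on the lines joining (u : v : w) to A, B and C.                        *)
Lemma anticevian_scalar_neq0 u v w i j k x y z : v != 0 -> w != 0 ->
    y * z = j * v * (k * w) -> z * x = k * w * (i * u) ->
    x * y = i * u * (j * v) ->
    x != i * u -> y != j * v -> z != k * w ->
  i != 0.
Proof.
move=> v0 w0 yz zx xy hx hy hz; apply/eqP => i0.
move: zx xy hx; rewrite i0 !mul0r mulr0 => zx xy hx.
have z0 : z = 0 by apply: (mulIf hx); rewrite zx mul0r.
have y0 : y = 0 by apply: (mulfI hx); rewrite xy mulr0.
move/eqP: yz; rewrite y0 mul0r eq_sym !mulf_eq0 (negPf v0) (negPf w0) !orbF.
by case/orP => /eqP e; [move: hy | move: hz]; rewrite ?y0 ?z0 e mul0r eqxx.
Qed.

Lemma anticevian_scalar_opp u v w i j k x y z : j * v * (k * w) != 0 ->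
    y * z = j * v * (k * w) -> z * x = k * w * (i * u) ->
    x * y = i * u * (j * v) -> x != i * u ->
  x = - (i * u).
Proof.
move=> n0 yz zx xy hx; apply/eqP; rewrite -addr_eq0; apply/eqP.
have hx' : x - i * u != 0 by rewrite subr_eq0.
apply: (mulfI hx'); apply: (mulfI n0).
(* Multiplying the last two relations and using the first gives x^2 = (i u)^2, and the root [i * u]
   is excluded. *)
transitivity ((z * x) * (x * y) - j * v * (k * w) * (i * u) ^+ 2).
  by rewrite -yz; ring.
by rewrite zx xy; ring.
Qed.

Lemma anticevian_scalars u v w i j k x y z :
    u != 0 -> v != 0 -> w != 0 ->
    y * z = j * v * (k * w) -> z * x = k * w * (i * u) ->
    x * y = i * u * (j * v) ->
    x != i * u -> y != j * v -> z != k * w ->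
  [/\ x = - (i * u), y = - (j * v), z = - (k * w) &
      [/\ i != 0, j != 0 & k != 0]].
Proof.
move=> u0 v0 w0 yz zx xy hx hy hz.
have i0 := anticevian_scalar_neq0 v0 w0 yz zx xy hx hy hz.
have j0 := anticevian_scalar_neq0 w0 u0 zx xy yz hy hz hx.
have k0 := anticevian_scalar_neq0 u0 v0 xy yz zx hz hx hy.
split=> //.
- by apply: anticevian_scalar_opp yz zx xy hx; rewrite !mulf_neq0.
- by apply: anticevian_scalar_opp zx xy yz hy; rewrite !mulf_neq0.
- by apply: anticevian_scalar_opp xy yz zx hz; rewrite !mulf_neq0.
Qed.

(** Each vertex lies on the line joining Q to a vertex of ABC, which leaves one unknown coordinate
    besides its scalar. The incidences of A, B, C with the sides then fix these coordinates up to
    sign, and distinctness from Q picks the minus sign. *)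
Lemma anticevian_bary u v w (Qa Qb Qc : 'rV[R]_3) :
    u != 0 -> v != 0 -> w != 0 -> anticevian a b c (pt u v w) Qa Qb Qc ->
  exists i j k, [/\ Qa = pt (- (i * u)) (i * v) (i * w),
    Qb = pt (j * u) (- (j * v)) (j * w), Qc = pt (k * u) (k * v) (- (k * w)) &
    [/\ i != 0, j != 0 & k != 0]].
Proof.
move=> u0 v0 w0 /and3P[].
have [x1 [y1 [z1 ->]]] := baryP abc Qa.
have [x2 [y2 [z2 ->]]] := baryP abc Qb.
have [x3 [y3 [z3 ->]]] := baryP abc Qc.
have d0 := det_abc_neq0 abc.
have a0 : a != 0 by rewrite (ordptA A B C) bary_eq0 // oner_eq0.
have b0 : b != 0 by rewrite (ordptB A B C) bary_eq0 // oner_eq0 andbF.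
have c0 : c != 0 by rewrite (ordptC A B C) bary_eq0 // oner_eq0 !andbF.
move=> hA hB hC.
have nA := line_neq0 a0 hA; have nB := line_neq0 b0 hB.
have nC := line_neq0 c0 hC.
have nprop i x y z : line (pt u v w) (pt x y z) != 0 ->
    x = i * u -> y = i * v -> z = i * w -> False.
  move=> n0 ex ey ez; move/eqP: n0; apply.
  by rewrite ex ey ez -baryZ /line crossZr cross_self scaler0.
move: hA hB hC.
move=> /dot_inter_eq0[A1 A2] /dot_inter_eq0[B1 B2] /dot_inter_eq0[C1 C2].
move: A1 A2 B1 B2 C1 C2; rewrite /line !cross_bary.
move: nA nB nC; rewrite (ordptA A B C) (ordptB A B C) (ordptC A B C) !dot_bary.
have cancel (s t : R) : d * s = 0 -> s = t -> t = 0.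
  by move=> h <-; apply: (mulfI d0); rewrite h mulr0.
have divE (s t e f : R) : t != 0 -> e * t = s * f -> e = s / t * f.
  by move=> t0 e1; apply: (mulIf t0); rewrite e1; field.
move=> nA nB nC A1 A2 B1 B2 C1 C2.
have z1E : z1 = y1 / v * w.
  apply: divE v0 _; apply/eqP; rewrite -subr_eq0; apply/eqP.
  by apply: cancel A2 _; ring.
have x2E : x2 = z2 / w * u.
  apply: divE w0 _; apply/eqP; rewrite -subr_eq0; apply/eqP.
  by apply: cancel B2 _; ring.
have y3E : y3 = x3 / u * v.
  apply: divE u0 _; apply/eqP; rewrite -subr_eq0; apply/eqP.
  by apply: cancel C2 _; ring.
have E1 : y2 * z3 = z2 * y3.
  by apply/eqP; rewrite -subr_eq0; apply/eqP; apply: cancel A1 _; ring.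
have E2 : z3 * x1 = x3 * z1.
  by apply/esym/eqP; rewrite -subr_eq0; apply/eqP; apply: cancel B1 _; ring.
have E3 : x1 * y2 = y1 * x2.
  by apply/eqP; rewrite -subr_eq0; apply/eqP; apply: cancel C1 _; ring.
exists (y1 / v), (z2 / w), (x3 / u).
have [] := @anticevian_scalars u v w (y1 / v) (z2 / w) (x3 / u)
  x1 y2 z3 u0 v0 w0.
- by rewrite E1 y3E; field; rewrite u0 w0.
- by rewrite E2 z1E; field; rewrite v0 u0.
- by rewrite E3 x2E; field; rewrite v0 w0.
- by apply/eqP=> e; apply: nprop nA e _ _; [field | exact: z1E].
- by apply/eqP=> e; apply: nprop nB _ e _; [exact: x2E | field].
- by apply/eqP=> e; apply: nprop nC _ _ e; [field | exact: y3E].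
move=> -> -> -> [i0 j0 k0]; split=> //; congr pt => //; by field.
Qed.

(** The diagonal points of the quadrangle are A, B, C. The midpoint of Q and Qa is proportional to
    (-u^2 : v(v + w) : w(v + w)), and the other midpoints are similar. *)
Lemma nine_point_conic_anticevian M u v w k (Qa Qb Qc : 'rV[R]_3) :
    M^T = M -> k != 0 -> u != 0 -> v != 0 -> w != 0 ->
    bilin M a a = 0 -> bilin M b b = 0 -> bilin M c c = 0 ->
    bilin M b c = k * u ^+ 2 -> bilin M c a = k * v ^+ 2 ->
    bilin M a b = k * w ^+ 2 ->
    anticevian a b c (pt u v w) Qa Qb Qc ->
  nine_point_conic (pt u v w) Qa Qb Qc M.
Proof.
move=> sM k0 u0 v0 w0 Maa Mbb Mcc Mbc Mca Mab.
case/(anticevian_bary u0 v0 w0) => i [j [l [-> -> -> _]]].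
apply/andP; split.
  apply/andP; split; first exact/eqP.
  apply: contraNneq (mulf_neq0 k0 (expf_neq0 2 u0)) => M0.
  by rewrite -Mbc M0 /bilin mulmx0 mul0mx mxE.
rewrite /nine_points /inter /line /= !cross_bary !cross_baryl !midpoint_bary.
rewrite !on_conicE !bilin_bary // Maa Mbb Mcc Mbc Mca Mab.
by do ?[apply/andP; split] => //; apply/eqP; ring.
Qed.

(** The pull-back passes through A, B, C because [T] sends them to the diagonal points of ABCP',
    which lie on [N]. *)
Lemma circumconic_bary p q r T N :
    let M := conic_image (invmx T) N in
    p != 0 -> q != 0 -> r != 0 ->
    q + r != 0 -> r + p != 0 -> p + q != 0 ->
    nine_point_conic a b c (pt p q r) N -> affine T ->
    a *m T = (q + r)^-1 *: pt 0 q r -> b *m T = (r + p)^-1 *: pt p 0 r ->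
    c *m T = (p + q)^-1 *: pt p q 0 ->
  exists2 k, k != 0 &
    [/\ M^T = M,
        [/\ bilin M a a = 0, bilin M b b = 0 & bilin M c c = 0] &
        [/\ bilin M b c = k * (q + r) ^+ 2, bilin M c a = k * (r + p) ^+ 2
          & bilin M a b = k * (p + q) ^+ 2]].
Proof.
move=> M p0 q0 r0 qr0 rp0 pq0 nN /andP[uT _] aT bT cT.
have [t t0 [sN [Naa Nbb Ncc] [Nbc Nca Nab]]] :=
  nine_point_conic_bary abc p0 q0 r0 qr0 rp0 pq0 nN.
exists (- (2%:R * t * p * q * r / ((q + r) * (r + p) * (p + q)))).
  by rewrite oppr_eq0 !mulf_neq0 ?invr_eq0 ?mulf_neq0 ?pnatr_eq0.
split.
- by rewrite /M /conic_image invmxK !trmx_mul trmxK sN mulmxA.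
- by split; rewrite /M bilin_conic_image (aT, bT, cT) bilinZl bilinZr
    bilin_bary // Naa Nbb Ncc Nbc Nca Nab; ring.
- by split; rewrite /M bilin_conic_image ?aT ?bT ?cT bilinZl bilinZr
    bilin_bary // Naa Nbb Ncc Nbc Nca Nab; field; rewrite ?qr0 ?rp0 ?pq0.
Qed.

End Circumconic.

(** * Generalized circumcenter and orthocenter in coordinates *)

Section Centers.
Variables (R : realFieldType) (A B C : 'rV[R]_2).
Implicit Types (x y z p q r u v w e f g k : R) (M N T : 'M[R]_3).
Implicit Types (O H : 'rV[R]_3).
Hypothesis abc : triangle A B C.

Local Notation a := (ordpt A).
Local Notation b := (ordpt B).
Local Notation c := (ordpt C).
Local Notation pt := (bary A B C).
Local Notation d := (det_abc A B C).

(* Twice the Conway symbol S_A of a triangle with sides q + r, r + p, p + q.  *)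
Definition conway p q r : R := (r + p) ^+ 2 + (p + q) ^+ 2 - (q + r) ^+ 2.

Definition circumcenter_bary p q r : 'rV[R]_3 :=
  pt ((q + r) ^+ 2 * conway p q r) ((r + p) ^+ 2 * conway q r p)
     ((p + q) ^+ 2 * conway r p q).

Definition orthocenter_bary p q r : 'rV[R]_3 :=
  pt (conway q r p * conway r p q) (conway r p q * conway p q r)
     (conway p q r * conway q r p).

(** By the identity S_A + S_B = w^2, two Conway symbols never vanish together. Hence the coordinate
    vectors of both centers are nonzero. *)
Lemma conway_neq0 p q r : p + q != 0 -> conway p q r = 0 -> conway q r p != 0.
Proof.
move=> pq0 h; have : 2%:R * (p + q) ^+ 2 != 0.
  by rewrite mulf_neq0 ?expf_neq0 ?pnatr_eq0.
have -> : 2%:R * (p + q) ^+ 2 = conway p q r + conway q r p.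
  by rewrite /conway; ring.
by rewrite h add0r.
Qed.

Lemma bary_proportional x y z x' y' z' :
    pt x y z != 0 -> pt x' y' z' != 0 ->
    x * y' = y * x' -> y * z' = z * y' -> z * x' = x * z' ->
  exists2 k, k != 0 & pt x y z = k *: pt x' y' z'.
Proof.
move=> n0 n0' xy yz zx.
suff [k e] : exists k, pt x y z = k *: pt x' y' z'.
  by exists k => //; apply: contraNneq n0 => k0; rewrite e k0 scale0r.
have [x0|x0] := eqVneq x' 0; last first.
  exists (x / x'); rewrite baryZ; congr pt; apply: (mulIf x0).
  - by field.
  - by rewrite -xy; field.
  - by rewrite zx; field.
have [y0|y0] := eqVneq y' 0; last first.
  exists (y / y'); rewrite baryZ; congr pt; apply: (mulIf y0).
  - by rewrite xy; field.
  - by field.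
  - by rewrite -yz; field.
have [z0|z0] := eqVneq z' 0; last first.
  exists (z / z'); rewrite baryZ; congr pt; apply: (mulIf z0).
  - by rewrite -zx; field.
  - by rewrite yz; field.
  - by field.
by move: n0'; rewrite bary_eq0 // x0 y0 z0 eqxx.
Qed.

(** The three parallelisms [L1], [L2], [L3] are the equations of the perpendicular bisectors for
    sides [u], [v], [w]. The scalars [e], [f], [g] absorb the factors that the trace formulas carry,
    so that the lemma serves both P and P'. *)
Lemma gen_circumcenter_eq p q r e f g O :
    e != 0 -> f != 0 -> g != 0 -> q + r != 0 -> r + p != 0 -> p + q != 0 ->
    gen_circumcenter A B C
      (pt ((q + r) / 2%:R) ((r + p) / 2%:R) ((p + q) / 2%:R))
      (pt 0 (e * r) (e * q)) (pt (f * r) 0 (f * p)) (pt (g * q) (g * p) 0) O ->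
  exists2 k, k != 0 & O = k *: circumcenter_bary p q r.
Proof.
move=> e0 f0 g0 qr0 rp0 pq0 /and4P[].
have d0 := det_abc_neq0 abc.
have [X [Y [Z ->]]] := baryP abc O.
move=> O0 /join_parallel_on hD /join_parallel_on hE /join_parallel_on hF.
move: hD hE hF; rewrite !(mid_bary A B C) /line !cross_bary.
rewrite !inter_linf // !dot_bary.
move=> hD hE hF.
have cancel (s t h : R) : s != 0 -> h = 0 -> h = - (d * s / 4%:R) * t -> t = 0.
  move=> s0 -> /esym/eqP; rewrite mulf_eq0 oppr_eq0 !mulf_eq0 invr_eq0.
  by rewrite pnatr_eq0 (negPf d0) (negPf s0) /= => /eqP.
have L1 : ((r + p) ^+ 2 - (p + q) ^+ 2) * X + (q + r) ^+ 2 * (Y - Z) = 0.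
  by apply: (cancel _ _ _ e0 hD); field.
have L2 : ((p + q) ^+ 2 - (q + r) ^+ 2) * Y + (r + p) ^+ 2 * (Z - X) = 0.
  by apply: (cancel _ _ _ f0 hE); field.
have L3 : ((q + r) ^+ 2 - (r + p) ^+ 2) * Z + (p + q) ^+ 2 * (X - Y) = 0.
  by apply: (cancel _ _ _ g0 hF); field.
have eq0 (s t h k l m : R) :
    h = 0 -> l = 0 -> s - t = - (k * h + m * l) -> s = t.
  by move=> -> -> e1; apply/eqP; rewrite -subr_eq0 e1 !mulr0 addr0 oppr0.
apply: bary_proportional => //.
- rewrite bary_eq0 //; apply/negP => /and3P[].
  rewrite !mulf_eq0 (negPf qr0) (negPf rp0) /= => /eqP h.
  by rewrite (negPf (conway_neq0 pq0 h)).
- by apply: (eq0 _ _ _ ((q + r) ^+ 2) _ ((r + p) ^+ 2) L2 L1);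
    rewrite /conway; ring.
- by apply: (eq0 _ _ _ ((r + p) ^+ 2) _ ((p + q) ^+ 2) L3 L2);
    rewrite /conway; ring.
- by apply: (eq0 _ _ _ ((p + q) ^+ 2) _ ((q + r) ^+ 2) L1 L3);
    rewrite /conway; ring.
Qed.

(** Here [L1], [L2], [L3] are the equations of the altitudes, S_C Z = S_B Y and its cyclic
    images. *)
Lemma gen_orthocenter_eq p q r e f g H :
    e != 0 -> f != 0 -> g != 0 -> q + r != 0 -> r + p != 0 -> p + q != 0 ->
    gen_orthocenter A B C
      (pt ((q + r) / 2%:R) ((r + p) / 2%:R) ((p + q) / 2%:R))
      (pt 0 (e * r) (e * q)) (pt (f * r) 0 (f * p)) (pt (g * q) (g * p) 0) H ->
  exists2 k, k != 0 & H = k *: orthocenter_bary p q r.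
Proof.
move=> e0 f0 g0 qr0 rp0 pq0 /and4P[].
have d0 := det_abc_neq0 abc.
have [X [Y [Z ->]]] := baryP abc H.
move=> O0 /join_parallel_on hD /join_parallel_on hE /join_parallel_on hF.
move: hD hE hF; rewrite (ordptA A B C) (ordptB A B C) (ordptC A B C) /line.
rewrite !cross_bary !inter_linf // !dot_bary.
move=> hD hE hF.
have cancel (s t t' h : R) :
    s != 0 -> h = 0 -> h = d * s / 4%:R * (t - t') -> t = t'.
  move=> s0 -> /esym/eqP; rewrite !mulf_eq0 invr_eq0 pnatr_eq0.
  by rewrite (negPf d0) (negPf s0) /= subr_eq0 => /eqP.
have L1 : conway r p q * Z = conway q r p * Y.
  by apply: (cancel _ _ _ _ e0 hD); rewrite /conway; field.
have L2 : conway p q r * X = conway r p q * Z.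
  by apply: (cancel _ _ _ _ f0 hE); rewrite /conway; field.
have L3 : conway q r p * Y = conway p q r * X.
  by apply: (cancel _ _ _ _ g0 hF); rewrite /conway; field.
apply: bary_proportional => //.
- rewrite bary_eq0 // !mulf_eq0; apply/negP => /and3P[].
  have [h|h] := eqVneq (conway p q r) 0.
    rewrite (negPf (conway_neq0 pq0 h)) /= => /eqP h2 _ _.
    by move: (conway_neq0 rp0 h2); rewrite h eqxx.
  rewrite /= orbF => _ /eqP h1 /eqP h2.
  by move: (conway_neq0 qr0 h2); rewrite h1 eqxx.
- transitivity (conway r p q * (conway p q r * X)); first by ring.
  by rewrite L2 L1; ring.
- by transitivity (conway p q r * (conway q r p * Y)); [ring|rewrite -L1; ring].
- by transitivity (conway q r p * (conway r p q * Z)); [ring|rewrite -L2; ring].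
Qed.

End Centers.

(** * Exchanging P and P': the effect on O and H *)

Section IsotomicConjugates.
Variables (R : realFieldType) (A B C : 'rV[R]_2).
Variables (p q r : R).
Implicit Types (k : R) (M T : 'M[R]_3).
Hypothesis abc : triangle A B C.

Local Notation a := (ordpt A).
Local Notation b := (ordpt B).
Local Notation c := (ordpt C).
Local Notation pt := (bary A B C).
Local Notation d := (det_abc A B C).

Local Notation e1 := (p + q + r).
Local Notation e2 := (q * r + r * p + p * q).
Local Notation e3 := (p * q * r).
Local Notation G := (pt 1 1 1).
Local Notation S := (pt (q * r) (r * p) (p * q)).
Local Notation S' := (pt p q r).
Local Notation dir := (e2 *: S' - e1 *: S).
Local Notation circum := (circumcenter_bary A B C).
Local Notation ortho := (orthocenter_bary A B C).

(** The first coordinate is symmetric in [q] and [r], and such polynomials have the basis 1, p, qr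
    over the symmetric ones, because qr = e2 - e1 p + p^2. The same coefficients serve the other two
    coordinates. *)
Lemma circumcenter_decomposition : circum p q r =
  2%:R *: ((e1 * (e1 * e2 + 3%:R * e3)) *: G + (- (2%:R * e1 ^+ 2)) *: S
           + (- (e1 * e2 + e3)) *: S').
Proof.
by rewrite /circumcenter_bary !(baryZ, baryD) /conway; congr pt; ring.
Qed.

(** Passing to (qr, rp, pq) turns e1, e2, e3 into e2, e1 e3, e3^2, and [S'], [S] into [S],
    [e3 *: S']. *)
Lemma circumcenter_decomposition_conj : circum (q * r) (r * p) (p * q) =
  2%:R *: ((e2 * e3 * (e1 * e2 + 3%:R * e3)) *: G
           + (- (e3 * (e1 * e2 + e3))) *: S + (- (2%:R * e2 ^+ 2 * e3)) *: S').
Proof.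
by rewrite /circumcenter_bary !(baryZ, baryD) /conway; congr pt; ring.
Qed.

(** This is the Euler line relation H = 3G - 2O, which reduces the orthocenter to the
    circumcenter. *)
Lemma orthocenter_circumcenter :
  ortho p q r = (16%:R * e1 * e3) *: G + (- 2%:R) *: circum p q r.
Proof.
rewrite /orthocenter_bary /circumcenter_bary !(baryZ, baryD) /conway.
by congr pt; ring.
Qed.

Lemma orthocenter_circumcenter_conj : ortho (q * r) (r * p) (p * q) =
  (16%:R * e2 * e3 ^+ 2) *: G + (- 2%:R) *: circum (q * r) (r * p) (p * q).
Proof.
rewrite /orthocenter_bary /circumcenter_bary !(baryZ, baryD) /conway.
by congr pt; ring.
Qed.

(** Heron's formula: in the model triangle this is sixteen times the squared area. *)
Lemma weight_circumcenter : weight (circum p q r) = 16%:R * e1 * e3.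
Proof. by rewrite /circumcenter_bary weight_bary /conway; ring. Qed.

Lemma weight_orthocenter : weight (ortho p q r) = 16%:R * e1 * e3.
Proof. by rewrite /orthocenter_bary weight_bary /conway; ring. Qed.

(* dir is the point at infinity of PP', so this shows OO' to be parallel to   *)
(* PP'; the scalar e2 vanishes when P, and then also O', is at infinity.      *)
Lemma circumcenter_shift : e1 != 0 -> circum (q * r) (r * p) (p * q) =
  (e2 * e3 / e1) *: circum p q r + (2%:R * e3 * (e3 - e1 * e2) / e1) *: dir.
Proof.
move=> e10; rewrite circumcenter_decomposition circumcenter_decomposition_conj.
by rewrite -scaleNr !(baryZ, baryD); congr pt; field.
Qed.

Lemma orthocenter_shift : e1 != 0 -> ortho (q * r) (r * p) (p * q) =
  (e2 * e3 / e1) *: ortho p q r + (- (4%:R * e3 * (e3 - e1 * e2) / e1)) *: dir.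
Proof.
move=> e10; rewrite orthocenter_circumcenter orthocenter_circumcenter_conj.
rewrite circumcenter_decomposition circumcenter_decomposition_conj.
by rewrite -scaleNr !(baryZ, baryD); congr pt; field.
Qed.

Lemma circumcenter_swap M : e1 != 0 -> e2 != 0 ->
    G *m M = G -> S *m M = (e2 / e1) *: S' -> S' *m M = (e1 / e2) *: S ->
  circum (q * r) (r * p) (p * q) = (e2 * e3 / e1) *: (circum p q r *m M).
Proof.
move=> e10 e20 MG MS MS'.
rewrite circumcenter_decomposition circumcenter_decomposition_conj.
rewrite -scalemxAl !mulmxDl -!scalemxAl MG MS MS' !(baryZ, baryD).
by congr pt; field; rewrite ?e10 ?e20.
Qed.

Lemma orthocenter_swap M : e1 != 0 -> e2 != 0 ->
    G *m M = G -> S *m M = (e2 / e1) *: S' -> S' *m M = (e1 / e2) *: S ->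
  ortho (q * r) (r * p) (p * q) = (e2 * e3 / e1) *: (ortho p q r *m M).
Proof.
move=> e10 e20 MG MS MS'.
rewrite orthocenter_circumcenter orthocenter_circumcenter_conj.
rewrite (circumcenter_swap e10 e20 MG MS MS').
rewrite [in RHS]mulmxDl -2!scalemxAl MG.
move: (circum p q r *m M) (G) => U U'; rewrite scalerDr !scalerA.
by congr (_ *: _ + _ *: _); field.
Qed.

Lemma circumcenterZ k x y z :
  circum (k * x) (k * y) (k * z) = k ^+ 4 *: circum x y z.
Proof. by rewrite /circumcenter_bary baryZ /conway; congr pt; ring. Qed.

Lemma orthocenterZ k x y z :
  ortho (k * x) (k * y) (k * z) = k ^+ 4 *: ortho x y z.
Proof. by rewrite /orthocenter_bary baryZ /conway; congr pt; ring. Qed.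

(** Since [S] and [S'] have weights e2 and e1 and an affine map preserves weight, the scalars in the
    exchange are forced. In particular the existence of eta forces e2 to be nonzero, so that P is
    ordinary. *)
Lemma swap_conjugates V M k : k != 0 -> e1 != 0 ->
    eta_reflection A B C (k *: S) S' V M ->
  [/\ e2 != 0, G *m M = G, S *m M = (e2 / e1) *: S' & S' *m M = (e1 / e2) *: S].
Proof.
move=> k0 e10 [aM fM [/proj_eqP[i i0 eS] /proj_eqP[j j0 eS']] _].
have w1 : k * e2 = i * e1.
  have := weight_affine (k *: S) aM; rewrite eS !baryZ !weight_bary => e.
  by transitivity (i * p + i * q + i * r); [rewrite e|]; ring.
have e20 : e2 != 0.
  by have := mulf_neq0 i0 e10; rewrite -w1 mulf_eq0 negb_or => /andP[].
have w2 : e1 = j * (k * e2).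
  have := weight_affine S' aM; rewrite eS' !baryZ !weight_bary => <-; ring.
split=> //.
- have : (ordpt (centroid A B C) *m M == ordpt (centroid A B C))%MS.
    apply: fM; first by rewrite centroid_bary bary_eq0 // invr_eq0 pnatr_eq0.
    by rewrite onE; apply/eqP; rewrite /line !coordE; ring.
  have -> : G = 3%:R *: ordpt (centroid A B C).
    by rewrite centroid_bary baryZ; congr pt; field.
  move=> /(affine_image aM) h; rewrite -scalemxAl h.
    by rewrite divff ?scale1r // weightE ordptE oner_eq0.
  by rewrite weightE ordptE oner_eq0.
- apply: (scalerI k0); rewrite scalemxAl eS scalerA; congr (_ *: _).
  by rewrite mulrA w1 mulfK.
- rewrite eS' scalerA; congr (_ *: _).
  by rewrite {1}w2; field.
Qed.

Lemma inter_line_linf k :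
  k != 0 -> (inter (line (k *: S) S') linf == dir)%MS.
Proof.
move=> k0; apply/proj_eqP; exists k => //.
rewrite -scaleNr !(baryZ, baryD) /line cross_bary inter_linf //.
by congr pt; ring.
Qed.

Lemma affine_taking_bary T k : k != 0 ->
    p != 0 -> q != 0 -> r != 0 -> q + r != 0 -> r + p != 0 -> p + q != 0 ->
    let P := k *: S in
    affine_taking A B C (refl_trace_a A B C P) (refl_trace_b A B C P)
      (refl_trace_c A B C P) T ->
  [/\ affine T, a *m T = (q + r)^-1 *: pt 0 q r,
      b *m T = (r + p)^-1 *: pt p 0 r & c *m T = (p + q)^-1 *: pt p q 0].
Proof.
move=> k0 p0 q0 r0 qr0 rp0 pq0 P /and4P[aT hA hB hC].
have d0 := det_abc_neq0 abc.
have image X (x y z l s : R) : l != 0 -> s != 0 -> x + y + z = s ->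
    (ordpt X *m T == l *: pt x y z)%MS -> ordpt X *m T = s^-1 *: pt x y z.
  move=> l0 s0 e; rewrite !eqmx_scale // => /(affine_image aT).
  by rewrite weight_bary e [weight (ordpt X)]weightE ordptE mul1r => ->.
split=> //.
- apply: (image _ _ _ _ (d * k * p)); rewrite ?mulf_neq0 ?add0r //.
  have -> : (d * k * p) *: pt 0 q r = refl_trace_a A B C P
    by rewrite /P !baryZ refl_trace_a_bary; congr pt; ring.
  exact: hA.
- apply: (image _ _ _ _ (d * k * q));
    rewrite ?mulf_neq0 ?addr0 1?[p + r]addrC //.
  have -> : (d * k * q) *: pt p 0 r = refl_trace_b A B C P
    by rewrite /P !baryZ refl_trace_b_bary; congr pt; ring.
  exact: hB.
- apply: (image _ _ _ _ (d * k * r)); rewrite ?mulf_neq0 ?addr0 //.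
  have -> : (d * k * r) *: pt p q 0 = refl_trace_c A B C P
    by rewrite /P !baryZ refl_trace_c_bary; congr pt; ring.
  exact: hC.
Qed.

End IsotomicConjugates.

(** * Parametrization of P and P', and assembly *)

(** P is off the sides exactly so that reciprocals exist. For P = (qr : rp : pq) the sums of two
    coordinates are p(q + r), q(r + p), r(p + q), so avoiding the anticomplementary sides makes [u],
    [v], [w] nonzero. *)
Lemma isotomic_parameters (R : realFieldType) (A B C : 'rV[R]_2)
    (P P' : 'rV[R]_3) :
  let a := ordpt A in let b := ordpt B in let c := ordpt C in
  let K := complement A B C in
  triangle A B C ->
  off_sides a b c P ->
  off_sides (a *m invmx K) (b *m invmx K) (c *m invmx K) P ->
  isotomic A B C P P' ->
  exists k p q r : R,
    [/\ P = k *: bary A B C (q * r) (r * p) (p * q), P' = bary A B C p q r,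
        [/\ k != 0, p != 0, q != 0 & r != 0] &
        [/\ q + r != 0, r + p != 0 & p + q != 0]].
Proof.
move=> a b c K abc.
have [x [y [z ->]]] := baryP abc P; have [p [q [r ->]]] := baryP abc P'.
rewrite off_sides_bary // => /and3P[x0 y0 z0].
rewrite off_anticomplementary_bary // => /and3P[yz0 zx0 xy0].
rewrite isotomic_bary // => /and4P[n0 /eqP yz /eqP zx /eqP xy].
have p0 : p != 0.
  apply: contraNneq n0 => p0; rewrite p0 mulr0 in zx xy.
  have q0 : q = 0 by apply: (mulfI y0); rewrite -xy mulr0.
  have r0 : r = 0 by apply: (mulfI z0); rewrite zx mulr0.
  by rewrite p0 q0 r0 bary_eq0 // eqxx.
have xp0 : x * p != 0 by rewrite mulf_neq0.
have q0 : q != 0 by apply: contraNneq xp0 => q0; rewrite xy q0 mulr0.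
have r0 : r != 0 by apply: contraNneq xp0 => r0; rewrite -zx r0 mulr0.
have k0 : x / (q * r) != 0 by rewrite !mulf_neq0 ?invr_eq0 ?mulf_neq0.
have yE : y = x / (q * r) * (r * p).
  by apply: (mulIf q0); rewrite -xy; field; rewrite q0 r0.
have zE : z = x / (q * r) * (p * q).
  by apply: (mulIf r0); rewrite zx; field; rewrite q0 r0.
exists (x / (q * r)), p, q, r; split=> //.
  by rewrite baryZ -yE -zE; congr bary; field; rewrite q0 r0.
split.
- apply: contraNneq yz0 => h; apply/eqP; rewrite yE zE.
  by transitivity (x / (q * r) * p * (q + r)); [ring | rewrite h mulr0].
- apply: contraNneq zx0 => h; apply/eqP; rewrite zE.
  transitivity (x / (q * r) * q * (r + p)); last by rewrite h mulr0.
  by field; rewrite q0 r0.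
- apply: contraNneq xy0 => h; apply/eqP; rewrite yE.
  transitivity (x / (q * r) * r * (p + q)); last by rewrite h mulr0.
  by field; rewrite q0 r0.
Qed.

Theorem theorem2p4 (R : realFieldType) (A B C : 'rV[R]_2) (P P' : 'rV[R]_3)
    (T N : 'M[R]_3) :
  let a := ordpt A in let b := ordpt B in let c := ordpt C in
  let K := complement A B C in
  let D := trace_a A B C P in
  let E := trace_b A B C P in
  let F := trace_c A B C P in
  let D3 := refl_trace_a A B C P in
  let E3 := refl_trace_b A B C P in
  let F3 := refl_trace_c A B C P in
  let Q := P' *m K in
  let Q' := P *m K in
  let V := inter (line P Q) (line P' Q') in
  let CO := conic_image (invmx T) N in
  triangle A B C ->
  P != 0 ->
  off_sides a b c P ->
  off_sides (a *m invmx K) (b *m invmx K) (c *m invmx K) P ->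
  isotomic A B C P P' ->
  affine_taking A B C D3 E3 F3 T ->
  nine_point_conic a b c P' N ->
  [/\ is_center N (Q *m K),
      [/\ [/\ on_conic CO a, on_conic CO b & on_conic CO c],
          forall Qa Qb Qc : 'rV[R]_3,
            anticevian a b c Q Qa Qb Qc -> nine_point_conic Q Qa Qb Qc CO
        & forall O : 'rV[R]_3,
            gen_circumcenter A B C Q D E F O ->
            is_center CO O /\ (O == Q *m K *m invmx T)%MS]
    & ~~ on_median A B C P -> ~ on_iota_linf A B C P ->
      forall O H O' H' : 'rV[R]_3,
        gen_circumcenter A B C Q D E F O ->
        gen_orthocenter A B C Q D E F H ->
        gen_circumcenter A B C Q' D3 E3 F3 O' ->
        gen_orthocenter A B C Q' D3 E3 F3 H' ->
        [/\ forall eta : 'M[R]_3, eta_reflection A B C P P' V eta ->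
              (O' == O *m eta)%MS /\ (H' == H *m eta)%MS,
            join_parallel O O' (line P P') &
            join_parallel H H' (line P P')]].
Proof.
move=> a b c K D E F D3 E3 F3 Q Q' V CO abc _ offP offKP isoP hT nN.
have [k [p [q [r [PE P'E [k0 p0 q0 r0] [qr0 rp0 pq0]]]]]] :=
  isotomic_parameters abc offP offKP isoP.
subst D E F D3 E3 F3 Q Q'.
have d0 := det_abc_neq0 abc.
have [aT TA TB TC] : [/\ affine T, a *m T = (q + r)^-1 *: bary A B C 0 q r,
    b *m T = (r + p)^-1 *: bary A B C p 0 r
    & c *m T = (p + q)^-1 *: bary A B C p q 0].
  have := affine_taking_bary abc k0 p0 q0 r0 qr0 rp0 pq0 (T := T).
  by rewrite /= -PE; apply.
have uT : T \in unitmx by case/andP: aT.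
rewrite P'E in nN.
have [t t0 [sCO [COa COb COc] [CObc COca COab]]] :=
  circumconic_bary abc p0 q0 r0 qr0 rp0 pq0 nN aT TA TB TC.
have circumP O : gen_circumcenter A B C (P' *m K) (trace_a A B C P)
    (trace_b A B C P) (trace_c A B C P) O ->
  exists2 o, o != 0 & O = o *: circumcenter_bary A B C p q r.
  move=> h; apply: (@gen_circumcenter_eq _ _ _ _ abc p q r
    (det_abc A B C * k * p) (det_abc A B C * k * q) (det_abc A B C * k * r) O);
    rewrite ?mulf_neq0 //.
  move: h; rewrite P'E PE !baryZ trace_a_bary trace_b_bary trace_c_bary.
  rewrite complement_bary.
  by congr gen_circumcenter; congr bary; ring.
have orthoP H : gen_orthocenter A B C (P' *m K) (trace_a A B C P)
    (trace_b A B C P) (trace_c A B C P) H ->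
  exists2 o, o != 0 & H = o *: orthocenter_bary A B C p q r.
  move=> h; apply: (@gen_orthocenter_eq _ _ _ _ abc p q r
    (det_abc A B C * k * p) (det_abc A B C * k * q) (det_abc A B C * k * r) H);
    rewrite ?mulf_neq0 //.
  move: h; rewrite P'E PE !baryZ trace_a_bary trace_b_bary trace_c_bary.
  rewrite complement_bary.
  by congr gen_orthocenter; congr bary; ring.
split.
- by rewrite P'E; apply: nine_point_conic_center nN.
- split.
  + by rewrite !on_conicE COa COb COc eqxx.
  + move=> Qa Qb Qc; rewrite P'E complement_bary.
    by apply: (nine_point_conic_anticevian abc (k := 4%:R * t) sCO) => //;
      rewrite ?mulf_neq0 ?invr_eq0 ?pnatr_eq0 // ?CObc ?COca ?COab; field.
  + move=> O /circumP[o o0 ->]; split.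
      (* The scalar is the common value of the form at O paired with A, B and C; the Conway symbols
         combine through identities such as S_B + S_C = u^2. *)
      apply: (is_center_bary abc (k := o *
          (2%:R * t * (q + r) ^+ 2 * (r + p) ^+ 2 * (p + q) ^+ 2)));
        rewrite ?bilinZl ?(bilin_vertices _ _ _ _ _ _ sCO)
          ?COa ?COb ?COc ?CObc ?COca ?COab /conway; try by ring.
      by rewrite !mulf_neq0 ?expf_neq0 // pnatr_eq0.
    (* The factor is the quotient of the weights: [o] times 16 e1 e3 for O and its image under [T],
       and e1 for K(Q). *)
    apply/proj_eqP; exists (16%:R * p * q * r * o).
      by rewrite !mulf_neq0 ?pnatr_eq0.
    rewrite scalemxAl; apply: (canRL (mulmxK uT)); rewrite -scalemxAl.
    rewrite [circumcenter_bary _ _ _ _ _ _ *m T]mulmxDl mulmxDl -!scalemxAl.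
    rewrite TA TB TC P'E !complement_bary !(baryZ, baryD) /conway.
    by congr bary; field; rewrite ?qr0 ?rp0 ?pq0.
- move=> _ Pfin O H O' H' /circumP[o o0 OE] /orthoP[h h0 HE] hO' hH'.
  (* If the sum vanishes, P' is at infinity, and P, as its isotomic conjugate, lies on the Steiner
     circumellipse. *)
  have e10 : p + q + r != 0.
    apply/eqP => e1; apply: Pfin; exists P'; split.
    + by rewrite P'E bary_eq0 // (negPf p0).
    + by rewrite P'E (linf_bary abc) on_bary // -!mulrDl e1 mul0r.
    + rewrite P'E PE baryZ isotomic_bary // bary_eq0 // !mulf_eq0.
      rewrite (negPf k0) (negPf q0) (negPf r0) /=.
      by apply/and3P; split; apply/eqP; ring.
  have sides : [/\ k * (r * p) + k * (p * q) != 0,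
      k * (p * q) + k * (q * r) != 0
      & k * (q * r) + k * (r * p) != 0].
    split.
    + by rewrite (_ : _ + _ = k * p * (q + r)) ?mulf_neq0 //; ring.
    + by rewrite (_ : _ + _ = k * q * (r + p)) ?mulf_neq0 //; ring.
    + by rewrite (_ : _ + _ = k * r * (p + q)) ?mulf_neq0 //; ring.
  case: sides => s1 s2 s3.
  (* For P' the lemma is applied with the coordinates of P as parameters, since the reflected traces
     of P are the traces of P'; homogeneity then removes [k]. *)
  have [o' o0' OE'] : exists2 o', o' != 0 &
      O' = o' *: circumcenter_bary A B C (q * r) (r * p) (p * q).
    move: hO'; rewrite PE !baryZ complement_bary.
    rewrite refl_trace_a_bary refl_trace_b_bary refl_trace_c_bary.
    case/(gen_circumcenter_eq abc d0 d0 d0 s1 s2 s3)=> j j0 ->.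
    exists (j * k ^+ 4); first by rewrite mulf_neq0 ?expf_neq0.
    by rewrite circumcenterZ scalerA.
  have [h' h0' HE'] : exists2 h', h' != 0 &
      H' = h' *: orthocenter_bary A B C (q * r) (r * p) (p * q).
    move: hH'; rewrite PE !baryZ complement_bary.
    rewrite refl_trace_a_bary refl_trace_b_bary refl_trace_c_bary.
    case/(gen_orthocenter_eq abc d0 d0 d0 s1 s2 s3)=> j j0 ->.
    exists (j * k ^+ 4); first by rewrite mulf_neq0 ?expf_neq0.
    by rewrite orthocenterZ scalerA.
  have e30 : p * q * r != 0 by rewrite !mulf_neq0.
  have dirP : (inter (line P P') linf ==
      (q * r + r * p + p * q) *: bary A B C p q r
      - (p + q + r) *: bary A B C (q * r) (r * p) (p * q))%MS.
    by rewrite PE P'E; apply: inter_line_linf.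
  split.
  + move=> eta; rewrite PE P'E => /(swap_conjugates abc k0 e10)[e20 mG mS mS'].
    have c0 : (q * r + r * p + p * q) * (p * q * r) / (p + q + r) != 0.
      by rewrite !mulf_neq0 ?invr_eq0.
    split; apply/proj_eqP.
    * exists (o' * ((q * r + r * p + p * q) * (p * q * r) / (p + q + r)) / o).
        by rewrite !mulf_neq0 ?invr_eq0.
      rewrite OE' OE (circumcenter_swap e10 e20 mG mS mS') -scalemxAl !scalerA.
      by rewrite divfK.
    * exists (h' * ((q * r + r * p + p * q) * (p * q * r) / (p + q + r)) / h).
        by rewrite !mulf_neq0 ?invr_eq0.
      rewrite HE' HE (orthocenter_swap e10 e20 mG mS mS') -scalemxAl !scalerA.
      by rewrite divfK.
  + have /and4P[O0' _ _ _] := hO'.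
    have wO : weight O != 0.
      rewrite OE weightE mxE -weightE.
      by rewrite weight_circumcenter !mulf_neq0 ?pnatr_eq0.
    have E : O' =
        (o' * ((q * r + r * p + p * q) * (p * q * r) / (p + q + r)) / o) *: O
        + (o' * (2%:R * (p * q * r) * (p * q * r - (p + q + r) *
            (q * r + r * p + p * q)) / (p + q + r))) *:
          ((q * r + r * p + p * q) *: bary A B C p q r
           - (p + q + r) *: bary A B C (q * r) (r * p) (p * q)).
      by rewrite OE' circumcenter_shift // scalerDr OE !scalerA divfK.
    by rewrite E; apply: join_parallel_shift; rewrite -?E.
  + have /and4P[H0' _ _ _] := hH'.
    have wH : weight H != 0.
      rewrite HE weightE mxE -weightE.
      by rewrite weight_orthocenter !mulf_neq0 ?pnatr_eq0.
    have E : H' =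
        (h' * ((q * r + r * p + p * q) * (p * q * r) / (p + q + r)) / h) *: H
        + (h' * - (4%:R * (p * q * r) * (p * q * r - (p + q + r) *
            (q * r + r * p + p * q)) / (p + q + r))) *:
          ((q * r + r * p + p * q) *: bary A B C p q r
           - (p + q + r) *: bary A B C (q * r) (r * p) (p * q)).
      by rewrite HE' orthocenter_shift // scalerDr HE !scalerA divfK.
    by rewrite E; apply: join_parallel_shift; rewrite -?E.
Qed.
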